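(* Let $\lambda\in\mathbb{C}\setminus\{0\}$ and let $f^n$ denote the $n$-th iterate of $f(z)=-2z^2$. If $f^n(\lambda)\in\{i,-i,2,-2\}$ for some integer $n\ge1$, then $G_\lambda$ is either parabolic dust or non-free.
   Context: For $\lambda\in\mathbb{C}\setminus\{0\}$, $G_\lambda=\langle S,T_\lambda\rangle$ is the subgroup of $PSL(2,\mathbb{C})$ generated by (the classes of) $S=\begin{pmatrix}1&0\\1&1\end{pmatrix}$ and $T_\lambda=\begin{pmatrix}1&2\lambda\\0&1\end{pmatrix}$. ''Non-free'' means that $G_\lambda$ is not a free group. $G_\lambda$ is not assumed discrete. If $G$ is a subgroup of $PSL(2,\mathbb{C})$, a parabolic element $h\in G$ is a primitive parabolic (of $G$) if $h=g^m$ with $g\in G$ and $m\in\mathbb{Z}$ implies $m=\pm1$. The group $G_\lambda$ (discrete or not) is called parabolic dust if it has a third conjugacy class of primitive parabolics, i.e. at least three conjugacy classes; here classes are counted as conjugacy classes in $G_\lambda$ of the cyclic subgroups generated by primitive parabolics, so that a parabolic and its inverse are not distinguished. *)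

(* Defs.v *)
From HB Require Import structures.
From mathcomp Require Import all_boot all_order all_algebra.
From mathcomp Require Import boolp classical_sets reals.
From mathcomp Require Import complex.

Set Implicit Arguments.
Unset Strict Implicit.
Unset Printing Implicit Defensive.

Import GRing.Theory.

Local Open Scope classical_set_scope.
Local Open Scope group_scope.
Local Open Scope ring_scope.
Local Open Scope quotient_scope.

Section SL2.
Variable F : fieldType.

Record SL2 := MkSL2 { sl2_mx :> 'M[F]_2; _ : \det sl2_mx == 1 }.

HB.instance Definition _ := [isSub for sl2_mx].
HB.instance Definition _ := [Choice of SL2 by <:].

Implicit Types A B C : SL2.

Lemma det_sl2 A : \det A = 1. Proof. exact: (eqP (valP A)). Qed.

Fact sl2_one_subproof : \det (1%:M : 'M[F]_2) == 1.
Proof. by rewrite det1. Qed.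
Definition sl2_one : SL2 := MkSL2 sl2_one_subproof.

Fact sl2_mul_subproof A B : \det (A *m B) == 1.
Proof. by rewrite det_mulmx !det_sl2 mulr1. Qed.
Definition sl2_mul A B : SL2 := MkSL2 (sl2_mul_subproof A B).

Fact sl2_inv_subproof A : \det (invmx A) == 1.
Proof. by rewrite det_inv det_sl2 invr1. Qed.
Definition sl2_inv A : SL2 := MkSL2 (sl2_inv_subproof A).

Lemma sl2_unitmx A : (A : 'M[F]_2) \in unitmx.
Proof. by rewrite unitmxE det_sl2 unitr1. Qed.

Fact sl2_mulA : associative sl2_mul.
Proof. by move=> A B C; apply: val_inj; rewrite /= mulmxA. Qed.
Fact sl2_mul1 : left_id sl2_one sl2_mul.
Proof. by move=> A; apply: val_inj; rewrite /= mul1mx. Qed.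
Fact sl2_mulr1 : right_id sl2_one sl2_mul.
Proof. by move=> A; apply: val_inj; rewrite /= mulmx1. Qed.
Fact sl2_mulV : left_inverse sl2_one sl2_inv sl2_mul.
Proof. by move=> A; apply: val_inj; rewrite /= mulVmx ?sl2_unitmx. Qed.
Fact sl2_mulrV : right_inverse sl2_one sl2_inv sl2_mul.
Proof. by move=> A; apply: val_inj; rewrite /= mulmxV ?sl2_unitmx. Qed.

HB.instance Definition _ :=
  isGroup.Build SL2 sl2_mulA sl2_mul1 sl2_mulr1 sl2_mulV sl2_mulrV.

Definition sl2_pm A B : bool :=
  ((A : 'M[F]_2) == B) || ((A : 'M[F]_2) == - (B : 'M[F]_2)).

Fact sl2_pm_refl : reflexive sl2_pm.
Proof. by move=> A; rewrite /sl2_pm eqxx. Qed.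
Fact sl2_pm_sym : symmetric sl2_pm.
Proof.
by move=> A B; rewrite /sl2_pm eq_sym; congr orb; rewrite eq_sym eqr_oppLR.
Qed.
Fact sl2_pm_trans : transitive sl2_pm.
Proof.
by move=> B A C; rewrite /sl2_pm => /orP[]/eqP-> /orP[]/eqP->;
   rewrite ?opprK eqxx ?orbT.
Qed.

Canonical sl2_pm_equiv := EquivRel sl2_pm sl2_pm_refl sl2_pm_sym sl2_pm_trans.

Definition PSL2 : Type := {eq_quot sl2_pm_equiv}.
HB.instance Definition _ := Choice.on PSL2.
HB.instance Definition _ := EqQuotient.on PSL2.

Definition psl (A : SL2) : PSL2 := \pi_PSL2 A.

Lemma pslP A B : reflect (psl A = psl B) (sl2_pm A B).
Proof.
apply: (iffP idP) => [AB | /eqP]; first by apply/eqP; rewrite /psl piE.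
by rewrite /psl piE.
Qed.

Lemma psl_reprK (x : PSL2) : psl (repr x) = x. Proof. exact: reprK. Qed.

Lemma repr_pslP A : sl2_pm (repr (psl A)) A.
Proof. by apply/pslP; rewrite psl_reprK. Qed.

Definition psl_one : PSL2 := psl 1%g.
Definition psl_mul (x y : PSL2) : PSL2 := psl (repr x * repr y)%g.
Definition psl_inv (x : PSL2) : PSL2 := psl (repr x)^-1%g.

Lemma psl_mulE A B : psl_mul (psl A) (psl B) = psl (A * B)%g.
Proof.
apply/pslP; rewrite /sl2_pm /=.
by case/orP: (repr_pslP A) => /eqP->; case/orP: (repr_pslP B) => /eqP->;
   rewrite ?mulNmx ?mulmxN ?opprK eqxx ?orbT.
Qed.

Lemma psl_invE A : psl_inv (psl A) = psl A^-1%g.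
Proof.
apply/pslP; rewrite /sl2_pm /=.
case/orP: (repr_pslP A) => /eqP->; rewrite ?eqxx // -scaleN1r invmxZ.
  by rewrite invrN1 scaleN1r eqxx orbT.
by rewrite unitmxZ ?unitrN1 ?sl2_unitmx.
Qed.

Fact psl_mulA : associative psl_mul.
Proof.
move=> x y z; rewrite -(psl_reprK x) -(psl_reprK y) -(psl_reprK z).
by rewrite !psl_mulE mulgA.
Qed.
Fact psl_mul1 : left_id psl_one psl_mul.
Proof. by move=> x; rewrite -(psl_reprK x) psl_mulE mul1g. Qed.
Fact psl_mulr1 : right_id psl_one psl_mul.
Proof. by move=> x; rewrite -(psl_reprK x) psl_mulE mulg1. Qed.
Fact psl_mulV : left_inverse psl_one psl_inv psl_mul.
Proof. by move=> x; rewrite -(psl_reprK x) psl_invE psl_mulE mulVg. Qed.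
Fact psl_mulrV : right_inverse psl_one psl_inv psl_mul.
Proof. by move=> x; rewrite -(psl_reprK x) psl_invE psl_mulE mulgV. Qed.

HB.instance Definition _ :=
  isGroup.Build PSL2 psl_mulA psl_mul1 psl_mulr1 psl_mulV psl_mulrV.

(* The trace is defined up to sign on PSL2, so its square is well defined. *)
Definition parabolic (h : PSL2) : Prop :=
  h <> 1%g /\ (\tr (repr h : 'M[F]_2)) ^+ 2 = 4.

Lemma parabolic_psl A :
  parabolic (psl A) <-> psl A <> 1%g /\ (\tr (A : 'M[F]_2)) ^+ 2 = 4.
Proof.
rewrite /parabolic; case/orP: (repr_pslP A) => /eqP-> //.
by rewrite linearN /= sqrrN.
Qed.

Definition mx2 (a b c d : F) : 'M[F]_2 :=
  \matrix_(i < 2, j < 2)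
    (if i == 0 then (if j == 0 then a else b) else (if j == 0 then c else d)).

Lemma det_mx2 a b c d : \det (mx2 a b c d) = a * d - b * c.
Proof.
rewrite (expand_det_row _ 0) !big_ord_recl big_ord0 addr0 /cofactor.
rewrite !det_mx11 !mxE /= expr0 expr1 mul1r mulN1r mulrN.
by [].
Qed.

Fact S_subproof : \det (mx2 1 0 1 1) == 1.
Proof. by rewrite det_mx2 mulr1 mul0r subr0. Qed.
Definition S_gen : PSL2 := psl (MkSL2 S_subproof).

Fact T_subproof (l : F) : \det (mx2 1 (2 * l) 0 1) == 1.
Proof. by rewrite det_mx2 mulr1 mulr0 subr0. Qed.
Definition T_gen (l : F) : PSL2 := psl (MkSL2 (T_subproof l)).

End SL2.

Section Groups.
Variable gT : groupType.
Implicit Types (G X : set gT) (g h k : gT).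

Definition is_subgroup G : Prop :=
  [/\ G 1%g, (forall g h, G g -> G h -> G (g * h)%g)
    & (forall g, G g -> G g^-1%g)].

Definition generated X : set gT := smallest is_subgroup X.

(* A letter (x, false) stands for x and a letter (x, true) for its inverse. *)
Definition word_eval (w : seq (gT * bool)) : gT :=
  (\prod_(p <- w) (if p.2 then p.1^-1 else p.1))%g.

Definition reduced (w : seq (gT * bool)) : bool :=
  sorted (fun p q => q != (p.1, ~~ p.2)) w.

(* X is a basis of G: X generates G and no nonempty reduced word in X is
   trivial. *)
Definition free_basis G X : Prop :=
  generated X = G /\
  forall w : seq (gT * bool), {in w, forall p, X p.1} ->
    reduced w -> w != [::] -> word_eval w <> 1%g.

Definition free_group G : Prop := exists X, free_basis G X.

Definition zpow g (m : int) : gT :=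
  match m with Posz n => (g ^+ n)%g | Negz n => (g ^- n.+1)%g end.

(* Conjugacy in G of the cyclic subgroups generated by h and k, so that an
   element and its inverse are identified. *)
Definition cyclic_conj G h k : Prop :=
  exists2 g, G g & [set (x ^ g)%g | x in generated [set h]] = generated [set k].

End Groups.

Section Dust.
Variable F : fieldType.
Implicit Types (G : set (PSL2 F)) (h : PSL2 F).

Definition primitive_parabolic G h : Prop :=
  [/\ G h, parabolic h
    & forall g (m : int), G g -> h = zpow g m -> m = 1 \/ m = -1].

Definition parabolic_dust G : Prop :=
  exists h1 h2 h3 : PSL2 F,
    [/\ primitive_parabolic G h1, primitive_parabolic G h2
      & primitive_parabolic G h3] /\
    [/\ ~ cyclic_conj G h1 h2, ~ cyclic_conj G h1 h3 & ~ cyclic_conj G h2 h3].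

Definition Glambda (l : F) : set (PSL2 F) := generated [set S_gen F; T_gen l].

End Dust.

(* Main.v *)
Require Import Defs.
From HB Require Import structures.
From mathcomp Require Import all_boot all_order all_algebra.
From mathcomp Require Import boolp classical_sets reals.
From mathcomp Require Import complex.
From mathcomp Require Import ring.

(** Write v = 2 l, and let Gamma be the subgroup of SL2 generated by the
    unipotent matrices S and T with off-diagonal entries 1 and v, so that
    G_l is the image of Gamma.  Assume that G_l is free.  The three classes are
    those of S, of T, and of a primitive root of an element P of Gamma that is
    parabolic with trace -2 instead of +2.

    Where P comes from: if A and B have trace 2 and A B has trace 2 + 2 z, then
    A and B A B^-1 have trace 2 and their product has trace 2 + 2 f(z)
    ([sl2_tr_mul_conj]).  Starting from S and T, iteration gives A and B in
    Gamma with trace (A B) = 2 + 2 f^n(l).  As f(i) = f(-i) = 2, the final value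
    may be taken to be 2 or -2, and then A B^-1 or A B has trace -2.

    Why -1 is not in Gamma: a homomorphic section of SL2 -> PSL2 over the free
    group G_l amounts to a choice of sign for each basis element.  G_l is not
    abelian, so it has two distinct basis elements, which give four distinct
    sections; each is determined by the two signs it gives to the generators S
    and T, so every pair of signs occurs.  The section that sends the classes of
    S and T to S and T has image Gamma and sends 1 only to 1
    ([free_negone_notin]).  This counting replaces the Hopf property of free
    groups.  Consequently P is not minus a conjugate of a power of S or T inside
    Gamma, and by its trace it is not such a conjugate either, so its root is
    conjugate to neither S nor T ([not_cyclic_conj_tr]).

    Why primitive roots exist: since 2 f(z) = -(2 z)^2, iteration shows that
    v^(2^n) is 4 or -4, so v is an algebraic integer that is not a unit.
    All entries of Gamma are algebraic integers, and the upper right entry is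
    moreover a multiple of v ([Gamma_entries]).  An m-th root of a parabolic
    divides its off-diagonal entries by m, up to sign ([parabolic_root]).  So S
    and T have no proper root, and the exponents of roots of P are bounded
    because a nonzero algebraic integer divides a nonzero integer.  Finally S
    cannot be conjugate into the powers of T, whose conjugates are congruent to
    the identity modulo the nonunit v ([not_cyclic_conj_ST]). *)

Set Implicit Arguments.
Unset Strict Implicit.
Unset Printing Implicit Defensive.

Import Order.TTheory GRing.Theory Num.Theory.
Local Open Scope classical_set_scope.
Local Open Scope ring_scope.

(** * Generated subgroups and words in a free basis *)

Section Subgroups.
Variable gT : groupType.
Implicit Types (G X : set gT) (g h : gT).

Lemma generated_subgroup X : is_subgroup (generated X).
Proof.
split=> [|g h Gg Gh|g Gg] H [subH sXH]; have [H1 HM HV] := subH.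
- exact: H1.
- by apply: HM; [apply: (Gg H) | apply: (Gh H)].
- by apply: HV; apply: (Gg H).
Qed.

Lemma generated_min X G : is_subgroup G -> X `<=` G -> generated X `<=` G.
Proof. exact: smallest_sub. Qed.

Lemma sub_generated X : X `<=` generated X.
Proof. exact: sub_gen_smallest. Qed.

Lemma subgroupX G g n : is_subgroup G -> G g -> G (g ^+ n)%g.
Proof.
move=> [G1 GM _] Gg; elim: n => [|n IHn]; first by rewrite expg0.
by rewrite expgS; apply: GM.
Qed.

Lemma generated_commute X :
    (forall x y, X x -> X y -> commute x y) ->
  forall g h, generated X g -> generated X h -> commute g h.
Proof.
have cent_subgroup (Y : set gT) :
    is_subgroup [set g | forall y, Y y -> commute y g].
  split=> [y _|g h /= cg ch y Yy|g /= cg y Yy]; first exact: commute1.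
    by apply: commuteM; [apply: cg|apply: ch].
  by apply/commuteV/cg.
move=> cX.
have cXG : generated X `<=` [set g | forall y, X y -> commute y g].
  by apply: (generated_min (cent_subgroup X)) => x Xx y Xy; apply: cX.
have cGG : generated X `<=` [set h | forall g, generated X g -> commute g h].
  apply: (generated_min (cent_subgroup (generated X))) => x Xx g Gg.
  exact/commute_sym/cXG.
by move=> g h Gg Gh; apply: cGG.
Qed.

Lemma zpow_expg g (m : int) :
  zpow g m = ((if m is Negz _ then g^-1 else g) ^+ `|m|%N)%g.
Proof. by case: m => n //=; rewrite -expVgn. Qed.

Lemma generated1_zpow g m : generated [set g] (zpow g m).
Proof.
have Ug := generated_subgroup [set g].
have Gg : generated [set g] g by apply: sub_generated.
rewrite zpow_expg; apply: (subgroupX _ Ug).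
by case: m => // n; case: Ug => _ _; apply.
Qed.

End Subgroups.

Section Words.
Variables gT hT : groupType.
Implicit Types (G X : set gT) (w : seq (gT * bool)) (F : gT -> hT).

(** The evaluation of a word in which each letter x is first sent to F x;
    [word_map id] is convertible to [word_eval]. *)
Definition word_map F w : hT :=
  (\prod_(p <- w) (if p.2 then (F p.1)^-1 else F p.1))%g.

Definition word_inv w : seq (gT * bool) :=
  rev [seq (p.1, ~~ p.2) | p <- w].

Lemma word_map_cat F w1 w2 :
  word_map F (w1 ++ w2) = (word_map F w1 * word_map F w2)%g.
Proof. by rewrite /word_map big_cat. Qed.

Lemma word_map_cons F p w :
  word_map F (p :: w) = ((if p.2 then (F p.1)^-1 else F p.1) * word_map F w)%g.
Proof. by rewrite /word_map big_cons. Qed.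

Lemma word_map_inv F w : word_map F (word_inv w) = (word_map F w)^-1%g.
Proof.
elim: w => [|[x b] w IHw]; first by rewrite /word_map !big_nil invg1.
rewrite /word_inv /= rev_cons -cats1 word_map_cat [word_map F (rev _)]IHw.
rewrite !word_map_cons /word_map big_nil mulg1 invgM; congr (_ * _)%g.
by case: b => //=; rewrite invgK.
Qed.

Lemma not_reduced_split w : ~~ reduced w ->
  exists w1 p w2, w = w1 ++ p :: (p.1, ~~ p.2) :: w2.
Proof.
elim: w => [//|p [//|q w] IHw]; rewrite /reduced /= negb_and negbK.
case/orP=> [/eqP-> | /IHw [w1 [r [w2 ->]]]]; first by exists [::], p, w.
by exists (p :: w1), r, w2.
Qed.

End Words.

Section FreeGroups.
Variables gT hT : groupType.
Implicit Types (G X : set gT) (w : seq (gT * bool)).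

Lemma generated_word X g : generated X g ->
  exists2 w, {in w, forall p, X p.1} & word_eval w = g.
Proof.
pose W := [set g | exists2 w, {in w, forall p, X p.1} & word_eval w = g].
move: g; apply: (@generated_min _ X W).
  split=> [|g h [w1 X1 <-] [w2 X2 <-]|g [w Xw <-]].
  - by exists [::] => //; rewrite /word_eval big_nil.
  - exists (w1 ++ w2); last exact: (word_map_cat id).
    by move=> p; rewrite mem_cat => /orP[/X1|/X2].
  - exists (word_inv w); last exact: (word_map_inv id).
    by move=> p; rewrite mem_rev => /mapP[q /Xw Xq ->].
move=> x Xx; exists [:: (x, false)]; last by rewrite /word_eval big_seq1.
by move=> p; rewrite inE => /eqP->.
Qed.

Variables (G X : set gT) (F : gT -> hT).
Hypothesis basisX : free_basis G X.

(** A trivial word over a basis is not reduced, so it contains a cancelling pair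
    of letters; deleting such pairs one at a time leads to the empty word, and
    this happens in the same way in hT.  This is the existence half of the
    universal property of G, for the map F on the basis. *)
Lemma free_relator w : {in w, forall p, X p.1} -> word_eval w = 1%g ->
  word_map F w = 1%g.
Proof.
have [n] := ubnP (size w); elim: n w => // n IHn w le_w_n Xw w1.
have [-> | w_neq0] := eqVneq w [::]; first by rewrite /word_map big_nil.
have /not_reduced_split[u [[x b] [v wE]]] : ~~ reduced w.
  by apply/negP=> redw; case: basisX => _ /(_ w Xw redw w_neq0).
(* Deleting a cancelling pair of letters changes no evaluation of the word. *)
have cancel (kT : groupType) (F' : gT -> kT) :
    word_map F' w = word_map F' (u ++ v).
  rewrite wE !word_map_cat !word_map_cons /=; case: b {wE} => /=.
    by rewrite mulKg.
  by rewrite mulVKg.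
rewrite cancel; apply: IHn.
- by move: le_w_n; rewrite wE !size_cat /= !addnS ltnS => /ltnW.
- by move=> p; rewrite mem_cat => /orP p_uv; apply: Xw; rewrite wE mem_cat !inE;
     case: p_uv => ->; rewrite ?orbT.
- by rewrite -w1; apply/esym/(cancel _ id).
Qed.

Lemma free_word_map w1 w2 :
    {in w1, forall p, X p.1} -> {in w2, forall p, X p.1} ->
  word_eval w1 = word_eval w2 -> word_map F w1 = word_map F w2.
Proof.
move=> X1 X2 eq12; apply/eqP; rewrite -divg_eq1; apply/eqP.
rewrite -word_map_inv -word_map_cat; apply: free_relator.
  move=> p; rewrite mem_cat mem_rev => /orP[/X1//|/mapP[q /X2 Xq ->]//].
rewrite [word_eval _](word_map_cat id) [word_map id (word_inv _)]word_map_inv.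
by rewrite [word_map id w1]eq12 mulgV.
Qed.

End FreeGroups.

(** * Lifts from PSL2 to SL2 *)

Section Lifts.
Variable F : fieldType.
Hypothesis two_neq0 : (2 : F) != 0.
Implicit Types (A B : SL2 F) (x y g : PSL2 F).

Fact sl2_negone_subproof : \det (- 1%:M : 'M[F]_2) == 1.
Proof. by rewrite -scaleN1r detZ det1 mulr1 sqrrN expr1n. Qed.
Definition sl2_negone : SL2 F := MkSL2 sl2_negone_subproof.

Lemma pslM A B : psl (A * B)%g = (psl A * psl B)%g.
Proof. by rewrite -psl_mulE. Qed.

Lemma pslV A : psl A^-1%g = (psl A)^-1%g.
Proof. by rewrite -psl_invE. Qed.

Lemma psl_negone : psl sl2_negone = 1%g.
Proof. by apply/pslP; rewrite /sl2_pm /= eqxx orbT. Qed.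

Lemma sl2_negoneM A : (sl2_negone * A)%g = - (A : 'M[F]_2) :> 'M[F]_2.
Proof. by rewrite /= mulNmx mul1mx. Qed.

Lemma sl2_mx_inj A B : A = B :> 'M[F]_2 -> A = B.
Proof. exact: val_inj. Qed.

Lemma psl_eqP A B : psl A = psl B <-> A = B \/ A = (sl2_negone * B)%g.
Proof.
split=> [/pslP/orP[]/eqP AB | [-> // | ->]].
- by left; apply: sl2_mx_inj.
- by right; apply: sl2_mx_inj; rewrite sl2_negoneM.
- by rewrite pslM psl_negone mul1g.
Qed.

Lemma sl2_negone_neq1 : sl2_negone != 1%g.
Proof.
apply/eqP => /(congr1 (fun A : SL2 F => A ord0 ord0)).
rewrite /= !mxE eqxx /= => /eqP; rewrite -subr_eq0 -opprD oppr_eq0.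
by rewrite -[1 + 1]/(2 : F) (negPf two_neq0).
Qed.

Lemma psl_lift (X : set (SL2 F)) (Y : set (PSL2 F)) :
  Y `<=` @psl F @` X ->
  forall g, generated Y g -> exists2 A, generated X A & psl A = g.
Proof.
move=> sYX; have [U1 UM UV] := generated_subgroup X.
pose U := [set g | exists2 A, generated X A & psl A = g].
apply: (@generated_min _ Y U) => [|y /sYX[A XA <-]]; last first.
  by exists A => //; apply: sub_generated.
split=> [|g h [A UA <-] [B UB <-]|g [A UA <-]].
- by exists 1%g.
- by exists (A * B)%g; rewrite ?pslM //; apply: UM.
- by exists A^-1%g; rewrite ?pslV //; apply: UV.
Qed.

(** Every matrix lift of x is obtained from [repr x] by a sign; a section over a
    free group is described by the restriction of e to a basis. *)
Definition sign_lift (e : PSL2 F -> bool) x : SL2 F :=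
  if e x then (sl2_negone * repr x)%g else repr x.

Lemma psl_sign_lift e x : psl (sign_lift e x) = x.
Proof.
by rewrite /sign_lift; case: (e x); rewrite ?pslM ?psl_negone ?mul1g psl_reprK.
Qed.

Lemma sign_lift_inj e e' x : sign_lift e x = sign_lift e' x -> e x = e' x.
Proof.
rewrite /sign_lift; case: (e x) (e' x) => [] [] // /eqP; last rewrite eq_sym;
  by rewrite -divg_eq1 mulgK (negPf sl2_negone_neq1).
Qed.

Lemma psl_word_map e w : psl (word_map (sign_lift e) w) = word_eval w.
Proof.
rewrite /word_eval -[RHS]/(word_map id w); elim: w => [|[x b] w IHw].
  by rewrite /word_map !big_nil.
rewrite !word_map_cons pslM IHw /=; congr (_ * _)%g.
by case: b; rewrite ?pslV psl_sign_lift.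
Qed.

(** A free nonabelian group generated by two elements has exactly
    four homomorphic sections in SL2, one for each pair of signs at the
    generators. *)
Lemma free_negone_notin A B :
    ~ commute (psl A) (psl B) -> free_group (generated [set psl A; psl B]) ->
  ~ generated [set A; B] sl2_negone.
Proof.
set G := generated _ => ncAB [X basisX]; have [genX _] := basisX.
have [GA GB] : G (psl A) /\ G (psl B).
  by split; apply: sub_generated; [left | right].
have [x [y [Xx Xy xDy]]] : exists x y, [/\ X x, X y & x != y].
  apply: contrapT => noXY; apply: ncAB.
  apply: (@generated_commute _ X); rewrite ?genX // => x y Xx Xy.
  have [-> //|xDy] := eqVneq x y; by case: noXY; exists x, y.
have wordG g : G g -> exists2 w, {in w, forall p, X p.1} & word_eval w = g.
  by rewrite -genX; apply: generated_word.
have [wA XwA evA] := wordG _ GA; have [wB XwB evB] := wordG _ GB.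
(* Only the signs at the two basis elements x and y vary. *)
pose e (s : bool * bool) z := if z == x then s.1 else s.2 && (z == y).
pose lift s := word_map (sign_lift (e s)).
pose signs s := (lift s wA == A, lift s wB == B).
have lift_signs s t C w : psl C = word_eval w ->
    (lift s w == C) = (lift t w == C) -> lift s w = lift t w.
  have negC : (sl2_negone * C == C)%g = false.
    by rewrite -divg_eq1 mulgK (negPf sl2_negone_neq1).
  have lift_cases u : psl C = word_eval w ->
      lift u w = C \/ lift u w = (sl2_negone * C)%g.
    by move=> evw; apply/psl_eqP; rewrite psl_word_map.
  by move=> evw; case: (lift_cases s evw) (lift_cases t evw) => [] -> [] ->;
     rewrite ?eqxx ?negC.
(* Sections that agree at the generators agree on G, in particular at x, y. *)
have signs_inj : injective signs.
  move=> s t [/(lift_signs _ _ _ _ (esym evA)) stA].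
  move=> /(lift_signs _ _ _ _ (esym evB)) stB.
  pose U := [set g | exists w, [/\ {in w, forall p, X p.1}, word_eval w = g
                                 & lift s w = lift t w]].
  have U_subgroup : is_subgroup U.
    split=> [|g h [w [Xw <- stw]] [w' [Xw' <- stw']]|g [w [Xw <- stw]]].
    - by exists [::]; rewrite /lift /word_map /word_eval !big_nil.
    - exists (w ++ w'); split; last 1 first.
        by rewrite /lift !word_map_cat; congr (_ * _)%g.
      by move=> p; rewrite mem_cat => /orP[/Xw|/Xw'].
      exact: (word_map_cat id).
    - exists (word_inv w); split; last 1 first.
        by rewrite /lift !word_map_inv; congr (_^-1)%g.
      by move=> p; rewrite mem_rev => /mapP[q /Xw Xq ->].
      exact: (word_map_inv id).
  have sGU : G `<=` U.
    apply: generated_min U_subgroup _ => _ [] ->; first by exists wA.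
    by exists wB.
  have est z : X z -> e s z = e t z.
    move=> Xz; have /sGU[w [Xw evw stw]] : G z.
      by rewrite -genX; apply: sub_generated.
    have letter u : sign_lift (e u) z = lift u w.
      rewrite /lift (free_word_map _ basisX Xw (w2 := [:: (z, false)])).
      - by rewrite /word_map big_seq1.
      - by move=> p; rewrite inE => /eqP->.
      - by rewrite evw /word_eval big_seq1.
    by apply: sign_lift_inj; rewrite !letter.
  case: s t est {stA stB U U_subgroup sGU} => [s1 s2] [t1 t2] est.
  have := est x Xx; have := est y Xy.
  by rewrite /e /= eqxx eq_sym (negPf xDy) eqxx !andbT => -> ->.
have [s signs_s] : exists s, signs s = (true, true).
  have [t tK sK] := injF_bij signs_inj.
  by exists (t (true, true)); rewrite sK.
case: signs_s => /eqP liftA /eqP liftB.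
(* The section s maps onto the whole group generated by A and B. *)
pose W := [set C | exists2 w, {in w, forall p, X p.1} & lift s w = C].
have W_subgroup : is_subgroup W.
  split=> [|C D [w Xw <-] [w' Xw' <-]|C [w Xw <-]].
  - by exists [::] => //; rewrite /lift /word_map big_nil.
  - exists (w ++ w'); last exact: word_map_cat.
    by move=> p; rewrite mem_cat => /orP[/Xw|/Xw'].
  - exists (word_inv w); last exact: word_map_inv.
    by move=> p; rewrite mem_rev => /mapP[q /Xw Xq ->].
move=> genN; have [w Xw liftw] : W sl2_negone.
  move: genN; apply: (generated_min W_subgroup) => _ [] ->.
    by exists wA.
  by exists wB.
have /eqP := sl2_negone_neq1; apply; rewrite -liftw.
apply: (free_relator _ basisX Xw).
by rewrite -(psl_word_map (e s)) [word_map _ w]liftw psl_negone.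
Qed.

End Lifts.

(** * Algebraic integers *)

Section Integrality.
Variable F : numFieldType.
Implicit Types (u v a b : F) (m : int).

Definition integral u : Prop := integralOver (intr : int -> F) u.

Lemma integral_intr m : integral m%:~R.
Proof. exact: integral_id. Qed.

(** Multiplying a monic equation of degree d for u by m^d and using m u = 1
    leaves 1 = m k with k an integer. *)
Lemma integral_intr_unit m u : integral u -> m%:~R * u = 1 -> m = 1 \/ m = -1.
Proof.
case=> p mon_p pu0 mu1.
have [d dE pd] : exists2 d, size p = d.+1 & p`_d = 1.
  exists (size p).-1; last by rewrite -lead_coefE (monicP mon_p).
  by rewrite prednK // lt0n size_poly_eq0 monic_neq0.
have [k mk1] : exists k : int, 1 = m * k; last first.
  have /eqP := congr1 absz mk1.
  rewrite abszM eq_sym muln_eq1 => /andP[/eqP m1 _].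
  by case: m m1 {mu1 mk1} => [[|[|]]|[]] // _; [left | right].
exists (- \sum_(i < d) p`_i * m ^+ (d - i.+1)); apply/(@intr_inj F)/eqP.
rewrite mulrN rmorphN /= -subr_eq0 opprK.
move: pu0; rewrite /root (horner_coef_wide _ (n := d.+1)); last first.
  by rewrite size_map_poly_id0 ?dE // (monicP mon_p) oner_eq0.
move/eqP/(congr1 (fun x => m%:~R ^+ d * x)); rewrite mulr0 => <-.
rewrite big_ord_recr mulrDr addrC coef_map /= pd.
rewrite mul1r -exprMn mu1 expr1n rmorphM rmorph_sum.
apply/eqP; congr (_ + _); rewrite !mulr_sumr; apply: eq_bigr => i _.
rewrite coef_map /= rmorphM rmorphXn /= mulrCA [RHS]mulrCA; congr (_ * _).
rewrite -exprS -subSn ?subSS //.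
move: (ltnW (ltn_ord i)); move: (i : nat) => j jd.
by rewrite -[in RHS](subnK jd) exprD -mulrA -exprMn mu1 expr1n mulr1.
Qed.

(** The rational number u = N / m is an algebraic integer, hence an integer.
    After division by the gcd, a Bezout relation x m' + y N' = 1 makes
    x + y u the inverse of m'. *)
Lemma integral_dvdz m N u : integral u -> m%:~R * u = N%:~R -> (m %| N)%Z.
Proof.
have [-> _ | m_neq0] := eqVneq m 0.
  by rewrite mul0r => /esym/eqP; rewrite intr_eq0 dvd0z.
move=> int_u muN; have [x [y xyg]] := Bezoutz m N; set g := gcdz m N in xyg.
have g_neq0 : g != 0 by rewrite gcdz_eq0 (negPf m_neq0).
have [m' m'g] := dvdzP (dvdz_gcdl m N); have [N' N'g] := dvdzP (dvdz_gcdr m N).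
have mu' : m'%:~R * u = N'%:~R.
  apply: (mulIf (x := g%:~R)); first by rewrite intr_eq0.
  by rewrite mulrAC -!intrM -m'g -N'g.
have bezout : x * m' + y * N' = 1.
  by apply: (mulIf g_neq0); rewrite mulrDl -!mulrA -m'g -N'g mul1r.
have [|m'1] : m' = 1 \/ m' = -1.
- apply: (@integral_intr_unit m' (x%:~R + y%:~R * u)).
    apply: integral_add; first exact: integral_intr.
    by apply: integral_mul => //; apply: integral_intr.
  by rewrite mulrDr mulrCA mu' mulrC -!intrM -intrD bezout.
- by move=> m'1; rewrite m'g m'1 mul1r dvdz_gcdr.
- by rewrite m'g m'1 mulN1r dvdzE abszN; apply: dvdz_gcdr.
Qed.

(** An equation q(a) a + c = 0 with a nonzero constant term c exhibits -q(a) as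
    a cofactor; a zero constant term can be divided out because a <> 0. *)
Lemma integral_dvd_intr a : integral a -> a != 0 ->
  exists (N : int) (b : F), [/\ N != 0, integral b & a * b = N%:~R].
Proof.
move=> int_a a0; case: (int_a) => p /monic_neq0.
elim/poly_ind: p => [|q c IHq]; first by rewrite eqxx.
move=> q0; rewrite /root rmorphD rmorphM /= map_polyX map_polyC hornerMXaddC /=.
have [c0 | c_neq0] := eqVneq c 0.
  rewrite c0 addr0 mulf_eq0 (negPf a0) orbF; apply: IHq.
  by apply: contraNneq q0 => ->; rewrite c0 mul0r addr0.
rewrite addr_eq0 => /eqP qa; exists c, (- (map_poly intr q).[a]); split=> //.
  apply: integral_opp; apply: integral_horner => //.
  by apply/integral_poly => i; rewrite coef_map; apply: integral_intr.
by rewrite mulrN mulrC qa opprK.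
Qed.

Definition integral_nonunit v : Prop :=
  integral v /\ forall b, integral b -> v * b <> 1.

Lemma integral_nonunit_sqrt v :
  integral_nonunit (- v ^+ 2) -> integral_nonunit v.
Proof.
case=> int_v2 nonunit_v2; split=> [|b int_b vb1].
  have root_v : root ('X^2 - (v ^+ 2)%:P) v by rewrite /root !hornerE subrr.
  apply: integral_root_monic (monicXnsubC _ (ltn0Sn _)) root_v _.
  apply/integral_poly => i; rewrite coefB coefXn coefC; apply: integral_sub.
    exact: integral_nat.
  case: ifP => _; last exact: integral0.
  by rewrite -[v ^+ 2]opprK; apply: integral_opp.
apply: (nonunit_v2 (- b ^+ 2)); last by rewrite mulrNN -exprMn vb1 expr1n.
by apply: integral_opp; rewrite expr2; apply: integral_mul.
Qed.

End Integrality.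

(** * Traces and parabolic elements of SL2 *)

Section Matrices.
Variable F : fieldType.
Implicit Types (A B H M Q X : SL2 F) (a b c d k t : F).

Lemma sum_ord2 (V : nmodType) (f : 'I_2 -> V) : \sum_i f i = f 0 + f 1.
Proof.
by rewrite !big_ord_recl big_ord0 addr0; congr (_ + f _); apply: val_inj.
Qed.

Lemma mx2_inj a b c d a' b' c' d' :
  mx2 a b c d = mx2 a' b' c' d' -> [/\ a = a', b = b', c = c' & d = d'].
Proof.
move=> /matrixP eqM; have := (eqM 0 0, eqM 0 1, eqM 1 0, eqM 1 1).
by rewrite !mxE /= => -[[[-> ->] ->] ->].
Qed.

Lemma mx2_eta (A : 'M[F]_2) : A = mx2 (A 0 0) (A 0 1) (A 1 0) (A 1 1).
Proof.
apply/matrixP=> i j; rewrite mxE.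
by case: i j => [[|[|]]] // ? [[|[|]]] // ?; congr (A _ _); apply: val_inj.
Qed.

Lemma mul_mx2 a b c d a' b' c' d' :
  mx2 a b c d *m mx2 a' b' c' d' =
  mx2 (a * a' + b * c') (a * b' + b * d') (c * a' + d * c') (c * b' + d * d').
Proof.
by apply/matrixP=> i j; rewrite !mxE sum_ord2 !mxE /=; do 2 case: ifP => _.
Qed.

Lemma opp_mx2 a b c d : - mx2 a b c d = mx2 (- a) (- b) (- c) (- d).
Proof. by apply/matrixP=> i j; rewrite !mxE; do 2 case: ifP => _. Qed.

Lemma tr_mx2 a b c d : \tr (mx2 a b c d) = a + d.
Proof. by rewrite /mxtrace sum_ord2 !mxE. Qed.

Lemma sl2_det A : A 0 1 * A 1 0 = A 0 0 * A 1 1 - 1.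
Proof.
rewrite -(det_sl2 A) [\det _](congr1 determinant (mx2_eta A)) det_mx2.
by rewrite subKr.
Qed.

Lemma sl2_tr A : \tr A = A 0 0 + A 1 1.
Proof. by rewrite /mxtrace sum_ord2. Qed.

Lemma sl2_mulE A B : (A * B)%g =
  mx2 (A 0 0 * B 0 0 + A 0 1 * B 1 0) (A 0 0 * B 0 1 + A 0 1 * B 1 1)
      (A 1 0 * B 0 0 + A 1 1 * B 1 0) (A 1 0 * B 0 1 + A 1 1 * B 1 1)
  :> 'M[F]_2.
Proof. by rewrite /= {1}(mx2_eta A) {1}(mx2_eta B) mul_mx2. Qed.

Lemma sl2_invE A :
  (A^-1)%g = mx2 (A 1 1) (- A 0 1) (- A 1 0) (A 0 0) :> 'M[F]_2.
Proof.
have detA := sl2_det A.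
have AA1 : sl2_mx A *m mx2 (A 1 1) (- A 0 1) (- A 1 0) (A 0 0) = 1%:M.
  rewrite {1}(mx2_eta A) mul_mx2 [RHS]mx2_eta !mxE /=.
  by congr (mx2 _ _ _ _); ring: detA.
by rewrite -[LHS]mulmx1 -AA1 /= mulKmx // sl2_unitmx.
Qed.

Lemma sl2_tr_conj A B : \tr (B^-1 * (A * B))%g = \tr A.
Proof. by rewrite /= mxtrace_mulC -mulmxA mulmxV ?mulmx1 // sl2_unitmx. Qed.

Lemma sl2_CayleyHamilton A : A *m A = \tr A *: (A : 'M[F]_2) - 1%:M.
Proof.
have detA := sl2_det A.
rewrite sl2_tr [RHS]mx2_eta [LHS](sl2_mulE A A) !mxE /=.
by congr (mx2 _ _ _ _); ring: detA.
Qed.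

(** Write A = t (1 + N).  Then N has trace and determinant 0, so N^2 = 0 and
    (1 + N)^n = 1 + n N. *)
Lemma sl2_expg A t n : \tr A = 2 * t -> t ^+ 2 = 1 ->
  (A ^+ n)%g = t ^+ n *: (1%:M + n%:R *: (t *: (A : 'M[F]_2) - 1%:M))
  :> 'M[F]_2.
Proof.
move=> trA t2; have := sl2_det A; have : A 1 1 = 2 * t - A 0 0.
  by rewrite -trA sl2_tr addrC addKr.
move=> -> detA; elim: n => [|n IHn].
  by rewrite expg0 expr0 scale1r scale0r addr0.
rewrite expgS sl2_mulE IHn [RHS]mx2_eta !mxE /= exprS -natr1.
have -> : A 1 1 = 2 * t - A 0 0 by rewrite -trA sl2_tr addrC addKr.
by congr (mx2 _ _ _ _); ring: detA t2.
Qed.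

(** With A = 1 + N and B = 1 + M, where N^2 = M^2 = 0, the trace of A B is
    2 + tr(N M), and the trace of A B A B^-1 is 2 - tr(N M)^2. *)
Lemma sl2_tr_mul_conj A B z : \tr A = 2 -> \tr B = 2 ->
    \tr (A * B)%g = 2 + 2 * z ->
  \tr (A * (B * (A * B^-1)))%g = 2 + 2 * (- 2 * z ^+ 2).
Proof.
have detA := sl2_det A; have detB := sl2_det B.
rewrite !sl2_tr => /eqP; rewrite addrC eq_sym -subr_eq => /eqP A11.
move=> /eqP; rewrite addrC eq_sym -subr_eq => /eqP B11.
move: detA detB; rewrite -A11 -B11 => detA detB.
have z2 : 2 * z = (2 + 2 * z) - 2 by ring.
rewrite !(sl2_mulE, sl2_invE, mxE) /= -A11 -B11 => trAB; rewrite -trAB in z2.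
have -> : 2 + 2 * (- 2 * z ^+ 2) = 2 - (2 * z) ^+ 2 by ring.
by rewrite z2; ring: detA detB.
Qed.

Lemma sl2_tr_mulV A B :
  \tr B = 2 -> \tr (A * B^-1)%g = 2 * \tr A - \tr (A * B)%g.
Proof.
rewrite !sl2_tr => /eqP; rewrite addrC eq_sym -subr_eq => /eqP B11.
by rewrite !(sl2_mulE, sl2_invE, mxE) /= -B11; ring.
Qed.

Lemma psl_diag_eq1 A : A 0 1 = 0 -> A 1 0 = 0 -> (\tr A) ^+ 2 = 4 ->
  psl A = 1%g.
Proof.
move=> b0 c0; rewrite sl2_tr => tr4.
have ad : A 0 0 * A 1 1 = 1.
  have := sl2_det A; rewrite b0 mul0r => /esym/eqP.
  by rewrite subr_eq0 => /eqP.
have : (A 0 0 - A 1 1) ^+ 2 = 0.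
  transitivity ((A 0 0 + A 1 1) ^+ 2 - 4 * (A 0 0 * A 1 1)); first by ring.
  by rewrite tr4 ad; ring.
move/eqP; rewrite sqrf_eq0 subr_eq0 => /eqP d0.
have : A 0 0 ^+ 2 == 1 by rewrite expr2 {2}d0 ad.
rewrite sqrf_eq1 => a1; apply/psl_eqP.
case/orP: a1 => /eqP a1; [left | right]; apply: sl2_mx_inj.
  by rewrite [LHS]mx2_eta [RHS]mx2_eta /= !mxE /= b0 c0 -d0 a1.
by rewrite sl2_negoneM [LHS]mx2_eta [RHS]mx2_eta /= !mxE /= b0 c0 -d0 a1 oppr0.
Qed.

(** Commutation makes (A11 - A00, A01, A10) proportional to the same triple for
    H.  The discriminant (tr X)^2 - 4 is a quadratic form in this triple, so it
    vanishes at A because it vanishes at H; the triple of H is nonzero because H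
    is not 1 or -1. *)
Lemma parabolic_centraliser A H :
  (\tr H) ^+ 2 = 4 -> psl H <> 1%g -> commute A H -> (\tr A) ^+ 2 = 4.
Proof.
move=> trH H1 /(congr1 (@sl2_mx F)).
rewrite !sl2_mulE => /mx2_inj[e00 e01 e10 _].
have eb : A 0 1 * H 1 0 = H 0 1 * A 1 0.
  by move: e00; rewrite mulrC => /addrI.
have e1 : A 0 1 * (H 1 1 - H 0 0) = H 0 1 * (A 1 1 - A 0 0).
  apply/eqP; rewrite -subr_eq0; move/eqP: e01; rewrite -subr_eq0.
  by congr (_ == _); ring.
have e2 : A 1 0 * (H 1 1 - H 0 0) = H 1 0 * (A 1 1 - A 0 0).
  apply/eqP; rewrite -subr_eq0; move/eqP: e10; rewrite -subr_eq0 -oppr_eq0.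
  by congr (_ == _); ring.
pose disc (X : SL2 F) := (X 1 1 - X 0 0) ^+ 2 + 4 * (X 0 1 * X 1 0).
have trE X : (\tr X) ^+ 2 = disc X + 4.
  rewrite sl2_tr /disc; have := sl2_det X => detX; ring: detX.
have discH : disc H = 0 by apply: (addIr 4); rewrite -trE trH add0r.
have disc1 : H 0 1 ^+ 2 * disc A = A 0 1 ^+ 2 * disc H.
  rewrite /disc !mulrDr -!exprMn -e1; congr (_ + _).
  transitivity (4 * (H 0 1 * A 0 1) * (H 0 1 * A 1 0)); first ring.
  by rewrite -eb; ring.
have disc2 : H 1 0 ^+ 2 * disc A = A 1 0 ^+ 2 * disc H.
  rewrite /disc !mulrDr -!exprMn -e2; congr (_ + _).
  transitivity (4 * (H 1 0 * A 1 0) * (A 0 1 * H 1 0)); first ring.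
  by rewrite eb; ring.
rewrite trE; suff -> : disc A = 0 by rewrite add0r.
apply: contrapT => /eqP discA; apply: H1; apply: psl_diag_eq1 => //.
  move/eqP: disc1; rewrite discH mulr0 mulf_eq0 sqrf_eq0 (negPf discA) orbF.
  by move/eqP.
move/eqP: disc2; rewrite discH mulr0 mulf_eq0 sqrf_eq0 (negPf discA) orbF.
by move/eqP.
Qed.

Lemma pslX A n : psl (A ^+ n)%g = (psl A ^+ n)%g.
Proof. by elim: n => [|n IHn]; rewrite ?expg0 // !expgS pslM IHn. Qed.

End Matrices.

Section Roots.
Variable F : numFieldType.
Implicit Types (A B H : SL2 F).

(** A root A of H commutes with H, so it is plus or minus a unipotent 1 + N, and
    H is plus or minus 1 + n N. *)
Lemma parabolic_expg_root A H n :
    parabolic (psl H) -> psl H = (psl A ^+ n)%g ->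
  parabolic (psl A) /\
  exists2 s : F, s = 1 \/ s = -1 &
    H 0 1 = s * n%:R * A 0 1 /\ H 1 0 = s * n%:R * A 1 0.
Proof.
move=> /parabolic_psl[H1 trH]; rewrite -pslX => HE.
have cAH : commute A H.
  have cAn : commute A (A ^+ n)%g by apply: commuteX.
  case/psl_eqP: HE => -> //; apply/(@sl2_mx_inj F).
  rewrite /= mulmxA !mulNmx !mul1mx mulmxN mulmx1 mulNmx; congr (- _).
  exact: (congr1 (@sl2_mx F) cAn).
have trA := parabolic_centraliser trH H1 cAH.
split.
  apply/parabolic_psl; split=> // A1; apply: H1.
  by rewrite HE pslX A1 expg1n.
have [t t2 trAt] : exists2 t : F, t ^+ 2 = 1 & \tr A = 2 * t.
  exists (\tr A / 2); last by rewrite mulrC divfK // pnatr_eq0.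
  by rewrite expr_div_n trA -natrX divff // pnatr_eq0.
have An := sl2_expg n trAt t2.
exists (if H == (A ^+ n)%g then t ^+ n * t else - (t ^+ n * t)).
  have : (t ^+ n * t) ^+ 2 == 1 by rewrite exprMn exprAC t2 expr1n mul1r.
  rewrite sqrf_eq1.
  by case: ifP => _ /orP[]/eqP->; rewrite ?opprK; [left|right|right|left].
case: eqP => [-> | HnA].
  by rewrite An !mxE /=; split; ring.
case/psl_eqP: HE => // ->; rewrite sl2_negoneM An !mxE /=; split; ring.
Qed.

Lemma parabolic_root A H m :
    parabolic (psl H) -> psl H = zpow (psl A) m ->
  parabolic (psl A) /\
  exists2 s : F, s = 1 \/ s = -1 &
    H 0 1 = s * m%:~R * A 0 1 /\ H 1 0 = s * m%:~R * A 1 0.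
Proof.
move=> parH; rewrite zpow_expg; case: m => n; first exact: parabolic_expg_root.
rewrite -pslV => /(parabolic_expg_root parH)[parA [s s1 [H01 H10]]]; split.
  move/parabolic_psl: parA => [A1 trA]; apply/parabolic_psl; split.
    by move=> A1'; apply: A1; rewrite pslV A1' invg1.
  by rewrite -trA !sl2_tr sl2_invE !mxE addrC.
exists s => //; rewrite H01 H10 sl2_invE !mxE /= NegzE mulrNz.
by split; ring.
Qed.

End Roots.

(** * Primitive parabolics of G_l *)

Section PrimitiveRoots.
Variable F : numFieldType.
Implicit Types (G : set (PSL2 F)) (g h : PSL2 F).

(** A root of h of largest exponent is primitive: a root of it with exponent j
    is a root of h whose exponent is |j| times larger. *)
Lemma primitive_root_exists G h (N : nat) :
    is_subgroup G -> G h -> parabolic h ->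
    (forall g m, G g -> h = zpow g m -> parabolic g) ->
    (forall g n, G g -> h = (g ^+ n)%g -> (n <= N)%N) ->
  exists g m, primitive_parabolic G g /\ h = zpow g m.
Proof.
move=> subG Gh parh par_root bound.
pose is_exponent n := `[< exists2 g, G g & h = (g ^+ n)%g >].
have exp1 : exists n, is_exponent n by exists 1%N; apply/asboolP; exists h.
have exp_le n : is_exponent n -> (n <= N)%N.
  by move=> /asboolP[g Gg /(bound _ _ Gg)].
have [n /asboolP[g Gg hg] max_n] := ex_maxnP exp1 exp_le.
exists g, n; split=> //; have parg := par_root g n Gg hg.
split=> // k j Gk gk.
pose k' := if j is Negz _ then (k^-1)%g else k.
have Gk' : G k'.
  by rewrite /k'; case: j {gk k'} => // _; case: subG => _ _; apply.
have gk' : g = (k' ^+ `|j|%N)%g by rewrite gk zpow_expg.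
have : (`|j| * n <= n)%N.
  by apply: max_n; apply/asboolP; exists k'; rewrite // expgnA -gk'.
have n_gt0 : (0 < n)%N by apply: max_n; apply/asboolP; exists h.
rewrite -{2}[n]mul1n leq_pmul2r //.
have : `|j|%N != 0%N by apply/eqP=> j0; case: parg; rewrite gk' j0 expg0.
by case: j {gk k' Gk' gk'} => [[|[|?]]|[|?]] // _ _; [left | right].
Qed.

End PrimitiveRoots.

Section GlambdaParabolics.
Variable F : numFieldType.
Implicit Types (l v z : F) (A B M X : SL2 F).

Definition S_mx : SL2 F := MkSL2 (S_subproof F).
Definition T_mx l : SL2 F := MkSL2 (T_subproof l).
Definition Gamma l : set (SL2 F) := generated [set S_mx; T_mx l].

Lemma Gamma_lift l g : Glambda l g -> exists2 A, Gamma l A & psl A = g.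
Proof.
apply: psl_lift => _ [] ->; first by exists S_mx; [left|].
by exists (T_mx l); [right|].
Qed.

Lemma Glambda_psl l A : Gamma l A -> Glambda l (psl A).
Proof.
have [G1 GM GV] := generated_subgroup [set S_gen F; T_gen l].
apply: (@generated_min _ _ [set A | Glambda l (psl A)]).
  split=> [|X Y /= GX GY|X /= GX]; first exact: G1.
    by rewrite pslM; apply: GM.
  by rewrite pslV; apply: GV.
by move=> _ [] ->; apply: sub_generated; [left|right].
Qed.

(** [sl2_tr_mul_conj] applied n times, replacing B by B A B^-1 each time. *)
Lemma trace_iterate l A B n z : Gamma l A -> Gamma l B ->
    \tr A = 2 -> \tr B = 2 -> \tr (A * B)%g = 2 + 2 * z ->
  exists A' B', [/\ Gamma l A' /\ Gamma l B', \tr A' = 2, \tr B' = 2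
    & \tr (A' * B')%g = 2 + 2 * iter n (fun z => -2 * z ^+ 2) z].
Proof.
have [_ GM GV] := generated_subgroup [set S_mx; T_mx l].
move=> GA GB trA trB; elim: n z B GB trB => [|n IHn] z B GB trB trAB.
  by exists A, B.
rewrite iterSr; apply: (IHn _ (B * (A * B^-1))%g).
- by apply: (GM _ _ GB); apply: GM => //; apply: GV.
- by have := sl2_tr_conj A B^-1%g; rewrite invgK => ->.
- exact: sl2_tr_mul_conj.
Qed.

Lemma Gamma_trace_m2 l n :
    iter n (fun z => -2 * z ^+ 2) l \in [:: 2; -2] ->
  exists2 P, Gamma l P & \tr P = -2.
Proof.
have [_ GM GV] := generated_subgroup [set S_mx; T_mx l].
have GS : Gamma l S_mx by apply: sub_generated; left.
have GT : Gamma l (T_mx l) by apply: sub_generated; right.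
have [||| A [B [[GA GB] trA trB trAB]]] := @trace_iterate l _ _ n l GS GT.
- by rewrite tr_mx2.
- by rewrite tr_mx2.
- by rewrite sl2_mulE /= tr_mx2 !mxE /=; ring.
rewrite !inE => /orP[]/eqP fl; rewrite fl in trAB.
  exists (A * B^-1)%g; first by apply: GM => //; apply: GV.
  by rewrite sl2_tr_mulV // trA trAB; ring.
by exists (A * B)%g; [apply: GM | rewrite trAB; ring].
Qed.

Lemma integral_nonunit_2l l n :
    iter n (fun z => -2 * z ^+ 2) l \in [:: 2; -2] ->
  integral_nonunit (2 * l).
Proof.
elim: n l => [|n IHn] l; last first.
  rewrite iterSr => /IHn; rewrite (_ : 2 * _ = - (2 * l) ^+ 2); last by ring.
  exact: integral_nonunit_sqrt.
move=> /= l2; have -> : 2 * l = (if l == 2 then 4 else - 4 : int)%:~R.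
  move: l2; rewrite !inE.
  by case: eqP => [-> _ | _ /eqP->]; rewrite ?rmorphN /=; ring.
split=> [|b int_b /(integral_intr_unit int_b)]; first exact: integral_intr.
by case: ifP => _ [].
Qed.

(** These matrices form a group: modulo v = 2 l they are the lower triangular
    ones. *)
Lemma Gamma_entries l A : integral (2 * l) -> Gamma l A ->
  [/\ integral (A 0 0), integral (A 1 0), integral (A 1 1)
    & exists2 b, integral b & A 0 1 = 2 * l * b].
Proof.
set v := 2 * l => int_v.
pose W := [set A : SL2 F | [/\ integral (A 0 0), integral (A 1 0),
  integral (A 1 1) & exists2 b, integral b & A 0 1 = v * b]].
have iD := @integral_add _ _ (intr : {rmorphism int -> F}).
have iM := @integral_mul _ _ (intr : {rmorphism int -> F}).
have iN := @integral_opp _ _ (intr : {rmorphism int -> F}).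
have i0 : integral (0 : F) := integral0 _.
have i1 : integral (1 : F) := integral1 _.
apply: (@generated_min _ _ W).
  split=> [|X Y [a1 c1 d1 [b1 ib1 b1E]] [a2 c2 d2 [b2 ib2 b2E]]
          |X [a c d [b ib bE]]].
  - by split; rewrite ?mxE //=; exists 0; rewrite // ?mxE /= mulr0.
  - split; rewrite sl2_mulE mxE /= ?b1E ?b2E.
    + by apply: (iD); apply: (iM) => //; apply: (iM).
    + by apply: (iD); apply: (iM).
    + by apply: (iD); apply: (iM) => //; apply: (iM).
    + exists (X 0 0 * b2 + b1 * Y 1 1); first by apply: (iD); apply: (iM).
      by ring.
  - split; rewrite sl2_invE mxE //=; first exact: iN.
    by exists (- b); [exact: iN | rewrite bE mulrN].
move=> _ [] ->; split; rewrite ?mxE //=.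
  by exists 0; rewrite // ?mxE /= mulr0.
by exists 1; rewrite // ?mxE /= mulr1.
Qed.

(** Since (M - 1)^2 = 0, the matrices 1 + k (M - 1) are closed under product and
    inverse. *)
Lemma cyclic_unipotent l M g : Gamma l M -> \tr M = 2 ->
    generated [set psl M] g ->
  exists X, [/\ Gamma l X, psl X = g
    & exists k : F, sl2_mx X = 1%:M + k *: (sl2_mx M - 1%:M)].
Proof.
move=> GM trM; set N := sl2_mx M - 1%:M.
have [G1 GMul GV] := generated_subgroup [set S_mx; T_mx l].
have N2 : N *m N = 0.
  rewrite /N mulmxBl mulmxBr sl2_CayleyHamilton trM mulmx1 mul1mx.
  rewrite scaler_nat mulr2n.
  by rewrite [X in X - _]addrAC addrK subrr.
pose W := [set X : SL2 F | Gamma l X /\ exists k : F, sl2_mx X = 1%:M + k *: N].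
have W_subgroup : is_subgroup W.
  split=> [|X Y [GX [k XE]] [GY [j YE]]|X [GX [k XE]]].
  - by split=> //; exists 0; rewrite scale0r addr0.
  - split; first exact: GMul.
    exists (k + j); rewrite /= XE YE mulmxDl mul1mx mulmxDr mulmx1.
    rewrite -scalemxAl -scalemxAr N2.
    by rewrite !scaler0 addr0 scalerDl -addrA (addrC (j *: N)).
  - split; first exact: GV.
    exists (- k); apply: (can_inj (mulKmx (sl2_unitmx X))).
    rewrite /= mulmxV ?sl2_unitmx // XE mulmxDl mul1mx mulmxDr mulmx1.
    rewrite -scalemxAl -scalemxAr N2.
    by rewrite !scaler0 addr0 scaleNr addrNK.
move=> /(@psl_lift _ [set M])[_ -> | X GX <-]; first by exists M.
have [GX' kX] : W X.
  move: GX; apply: (generated_min W_subgroup) => _ ->.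
  by split=> //; exists 1; rewrite scale1r addrC subrK.
by exists X.
Qed.

(** Otherwise psl P would be the class of a conjugate Y of a power of M.  Then Y
    has trace 2, so Y = P is impossible, and Y = - P would put -1 in Gamma. *)
Lemma not_cyclic_conj_tr l M P g m :
    ~ Gamma l (sl2_negone F) -> Gamma l M -> \tr M = 2 ->
    Gamma l P -> \tr P = -2 -> psl P = zpow g m ->
  ~ cyclic_conj (Glambda l) (psl M) g.
Proof.
move=> nGneg GM trM GP trP Pg [q /Gamma_lift[Q GQ <-] imM].
have [_ GMul GV] := generated_subgroup [set S_mx; T_mx l].
have : generated [set g] (psl P) by rewrite Pg; apply: generated1_zpow.
rewrite -imM => -[_ /(cyclic_unipotent GM trM)[X [GX <- [k XE]]]].
have trX : \tr X = 2.
  by rewrite XE mxtraceD mxtraceZ raddfB /= mxtrace1 trM subrr mulr0 addr0.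
rewrite /conjg -pslV -(pslM X) -pslM; set Y := (_ * _)%g => YP.
have trY : \tr Y = 2 by rewrite /Y sl2_tr_conj.
have GY : Gamma l Y by apply: (GMul); [apply: (GV) | apply: (GMul)].
case/psl_eqP: YP => YP.
  move/eqP: trY; rewrite YP trP -subr_eq0 -opprD oppr_eq0 -natrD pnatr_eq0.
  by [].
apply: nGneg; rewrite -[sl2_negone F](mulgK P) -YP.
by apply: (GMul) => //; apply: (GV).
Qed.

Section Primitive.
Variable l : F.
Hypotheses (l_neq0 : l != 0) (nonunit_2l : integral_nonunit (2 * l)).

Let GS : Gamma l S_mx. Proof. by apply: sub_generated; left. Qed.
Let GT : Gamma l (T_mx l). Proof. by apply: sub_generated; right. Qed.
Let tr_S : \tr S_mx = 2. Proof. by rewrite tr_mx2. Qed.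
Let tr_T : \tr (T_mx l) = 2. Proof. by rewrite tr_mx2. Qed.

Lemma integral_signM (s a : F) :
  s = 1 \/ s = -1 -> integral a -> integral (s * a).
Proof. by case=> ->; rewrite ?mulN1r ?mul1r // => ia; apply: integral_opp. Qed.

Lemma psl_eq1_entries A : psl A = 1%g -> A 0 1 = 0 /\ A 1 0 = 0.
Proof.
rewrite -[1%g]/(psl 1%g) => /psl_eqP[] ->;
  by rewrite ?sl2_negoneM !mxE /= ?oppr0.
Qed.

Lemma parabolic_S : parabolic (S_gen F).
Proof.
apply/parabolic_psl; split; last by rewrite tr_S; ring.
by move=> /(@psl_eq1_entries S_mx)[_ /eqP]; rewrite mxE oner_eq0.
Qed.

Lemma parabolic_T : parabolic (T_gen l).
Proof.
apply/parabolic_psl; split; last by rewrite tr_T; ring.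
move=> /(@psl_eq1_entries (T_mx l))[/eqP]; rewrite mxE /=.
by rewrite mulf_eq0 (negPf l_neq0) pnatr_eq0.
Qed.

(** If S = A^m up to sign, the lower left entry gives 1 = m A10 up to sign, with
    A10 an algebraic integer. *)
Lemma primitive_S : primitive_parabolic (Glambda l) (S_gen F).
Proof.
split; [exact: Glambda_psl GS | exact: parabolic_S |].
move=> g m /Gamma_lift[A /(Gamma_entries nonunit_2l.1)[_ int_A10 _ _] <-].
move=> /(parabolic_root (H := S_mx) parabolic_S)[_ [s s1 [_]]].
rewrite mxE /= mulrAC mulrC => /esym.
by apply: integral_intr_unit; apply: integral_signM.
Qed.

(** If T = A^m up to sign, the upper right entry gives v = m v b up to sign,
    where v = 2 l and b is an algebraic integer. *)
Lemma primitive_T : primitive_parabolic (Glambda l) (T_gen l).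
Proof.
split; [exact: Glambda_psl GT | exact: parabolic_T |].
move=> g m /Gamma_lift[A /(Gamma_entries nonunit_2l.1)[_ _ _ [b int_b A01]] <-].
move=> /(parabolic_root (H := T_mx l) parabolic_T)[_ [s s1 [+ _]]].
rewrite mxE /= A01 => smb.
apply: (@integral_intr_unit F m (s * b)); first exact: integral_signM.
apply: (mulfI (x := 2 * l)); first by rewrite mulf_neq0 ?pnatr_eq0.
by rewrite mulr1 [RHS]smb; ring.
Qed.

(** If S is conjugate up to sign to a power X of T, comparing lower left entries
    gives 1 = v b c^2 up to sign, where v = 2 l, X01 = v b and c is an
    entry of the conjugating matrix: v would be a unit. *)
Lemma not_cyclic_conj_ST : ~ cyclic_conj (Glambda l) (S_gen F) (T_gen l).
Proof.
move=> [q /Gamma_lift[Q GQ <-] imS].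
have : generated [set T_gen l] (S_gen F ^ psl Q)%g.
  by rewrite -imS; exists (S_gen F) => //; apply: sub_generated.
move=> /(cyclic_unipotent GT tr_T)[X [GX + [k XE]]].
have [int_v nonunit_v] := nonunit_2l.
have [_ _ _ [b int_b X01]] := Gamma_entries int_v GX.
have [_ int_c _ _] := Gamma_entries int_v GQ.
have X10 : X 1 0 = 0 by rewrite XE !mxE /= subrr mulr0 addr0.
have X00 : X 0 0 = 1 by rewrite XE !mxE /= subrr mulr0 addr0.
have X11 : X 1 1 = 1 by rewrite XE !mxE /= subrr mulr0 addr0.
rewrite /conjg -pslV -[S_gen F]/(psl S_mx) -(pslM S_mx) -pslM => XS.
have : psl S_mx = psl (Q * (X * Q^-1))%g.
  by rewrite !pslM XS !pslM pslV !mulgA mulgV mul1g mulgK.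
set Y := (Q * _)%g => SY.
have Y10 : Y 1 0 = - (2 * l * (b * (Q 1 0) ^+ 2)).
  by rewrite /Y !(sl2_mulE, sl2_invE, mxE) /= X10 X00 X11 X01; ring.
clearbody Y.
have int_bc : integral (b * Q 1 0 ^+ 2).
  by apply: integral_mul => //; rewrite expr2; apply: integral_mul.
have S10 : S_mx 1 0 = 1 by rewrite mxE.
case/psl_eqP: SY => /(congr1 (fun A : SL2 F => A 1 0));
  rewrite ?sl2_negoneM S10.
  rewrite Y10 -mulrN => /esym; apply: nonunit_v; exact: integral_opp.
by rewrite !mxE Y10 opprK => /esym; apply: nonunit_v.
Qed.

Lemma not_commute_ST : ~ commute (S_gen F) (T_gen l).
Proof.
rewrite /commute -!pslM => /psl_eqP[] /(congr1 (@sl2_mx F)).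
  rewrite ?sl2_negoneM !sl2_mulE !mxE /= => /mx2_inj[/eqP + _ _ _].
  rewrite mul1r mulr0 mulr1 addr0 addrC -subr_eq subrr eq_sym mulf_eq0.
  by rewrite (negPf l_neq0) pnatr_eq0.
rewrite ?sl2_negoneM !sl2_mulE !mxE /= opp_mx2 => /mx2_inj[_ _ + _].
rewrite !(mul0r, mulr0, mul1r, mulr1, add0r, addr0) => /eqP.
by rewrite -subr_eq0 opprK -[1 + 1]/(2%:R) pnatr_eq0.
Qed.

(** A nonzero off-diagonal entry of h divides some nonzero integer N in the ring
    of algebraic integers, so an exponent of a root of h divides N. *)
Lemma primitive_root_Glambda h : Glambda l h -> parabolic h ->
  exists g m, primitive_parabolic (Glambda l) g /\ h = zpow g m.
Proof.
move=> Gh parh; have [H GH hE] := Gamma_lift Gh; rewrite -hE in parh *.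
pose off_diagonal (i j : 'I_2) := (i, j) \in [:: (0, 1); (1, 0)].
have offdiag_int i j A : off_diagonal i j -> Gamma l A -> integral (A i j).
  move=> ij /(Gamma_entries nonunit_2l.1)[_ A10 _ [b int_b A01]].
  move: ij; rewrite /off_diagonal !inE => /orP[]/eqP[-> ->] //.
  by rewrite A01; apply: integral_mul => //; case: nonunit_2l.
have [i [j [ij H_ij]]] : exists i j, off_diagonal i j /\ H i j != 0.
  have [H01|] := eqVneq (H 0 1) 0; last by exists 0, 1.
  have [H10|] := eqVneq (H 1 0) 0; last by exists 1, 0.
  by case/parabolic_psl: parh => H1 trH; case: H1; apply: psl_diag_eq1.
have [N [b [N_neq0 int_b HbN]]] :=
  integral_dvd_intr (offdiag_int _ _ _ ij GH) H_ij.
apply: (@primitive_root_exists _ _ _ `|N|%N).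
- exact: generated_subgroup.
- exact: Glambda_psl.
- exact: parh.
- by move=> g m /Gamma_lift[A _ <-] /(parabolic_root parh)[].
move=> g n /Gamma_lift[A GA <-] /(parabolic_expg_root parh)[_ [s s1 HA]].
have HijA : H i j = s * n%:R * A i j.
  by move: ij HA; rewrite /off_diagonal !inE => /orP[]/eqP[-> ->] [].
apply: dvdn_leq; first by rewrite absz_gt0.
apply: (@integral_dvdz F n N (s * (A i j * b))).
  by apply: integral_signM => //; apply: integral_mul => //; apply: offdiag_int.
by rewrite -HbN HijA -pmulrn; ring.
Qed.

End Primitive.

Theorem dust_or_nonfree l n : l != 0 ->
    iter n (fun z => -2 * z ^+ 2) l \in [:: 2; -2] ->
  parabolic_dust (Glambda l) \/ ~ free_group (Glambda l).
Proof.
move=> l_neq0 fl; have nonunit_2l := integral_nonunit_2l fl.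
have [freeG | ] := pselect (free_group (Glambda l)); [left | by right].
have [P GP trP] := Gamma_trace_m2 fl.
have two_neq0 : (2 : F) != 0 by rewrite pnatr_eq0.
have nGneg : ~ Gamma l (sl2_negone F).
  exact: (free_negone_notin two_neq0 (not_commute_ST l_neq0) freeG).
have parP : parabolic (psl P).
  apply/parabolic_psl; split; last by rewrite trP; ring.
  rewrite -[1%g]/(psl 1%g) => /psl_eqP[] PE.
    move/eqP: trP; rewrite PE mxtrace1 -subr_eq0 opprK -natrD pnatr_eq0.
    by [].
  by apply: nGneg; rewrite -[sl2_negone F]mulg1 -PE.
have [g [m [prim_g Pg]]] :=
  primitive_root_Glambda nonunit_2l (Glambda_psl GP) parP.
exists (S_gen F), (T_gen l), g; split.
  by split=> //; [exact: primitive_S | exact: primitive_T].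
split; first exact: not_cyclic_conj_ST.
  apply: (not_cyclic_conj_tr nGneg _ _ GP trP Pg); last by rewrite tr_mx2.
  by apply: sub_generated; left.
apply: (not_cyclic_conj_tr nGneg _ _ GP trP Pg); last by rewrite tr_mx2.
by apply: sub_generated; right.
Qed.

End GlambdaParabolics.


Theorem corollary7p2 (R : realType) (l : R[i]) (hl : l != 0) (n : nat)
    (hn : (1 <= n)%N)
    (hf : iter n (fun z : R[i] => -2 * z ^+ 2) l \in [:: 'i%C; - 'i%C; 2; -2]) :
  parabolic_dust (Glambda l) \/ ~ free_group (Glambda l).
Proof.
have [f2 | fN2] := boolP (iter n (fun z => -2 * z ^+ 2) l \in [:: 2; -2]).
  exact: dust_or_nonfree hl f2.
apply: (@dust_or_nonfree _ l n.+1 hl); rewrite iterS.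
have -> : iter n (fun z => -2 * z ^+ 2) l ^+ 2 = -1.
  move: hf fN2; rewrite !inE => /or4P[]/eqP->; rewrite ?eqxx ?orbT // => _.
    exact: sqr_i.
  by rewrite sqrrN sqr_i.
by rewrite mulrN1 opprK !inE eqxx.
Qed.
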